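(* Let $n\ge 1$, let $\mathcal{M}=\mathbb{S}_{++}^n$, and for $\Sigma\in\mathcal{M}$ let $\Sigma=LL^\top$ be its Cholesky decomposition. Map every tangent vector $\xi\in T_\Sigma\mathcal{M}$ to $\xi':=L^{-1}\,\xi\,L^{-\top}$, equivalently $\xi=L\,\xi'\,L^\top$. Then the operators on $\mathcal{M}$, expressed in terms of mapped tangent vectors (as defined in the context), satisfy the following. (1) Metric: for all $\Sigma\in\mathcal{M}$ and all mapped tangent vectors $\xi',\eta'$ at $\Sigma$, $g'_\Sigma(\xi',\eta')=\mathrm{tr}(\xi'\eta')$. (2) Gradient: for every differentiable $f$ and every $\Sigma\in\mathcal{M}$, $\nabla' f(\Sigma)=\tfrac12\,L^\top\big(\nabla_E f(\Sigma)+(\nabla_E f(\Sigma))^\top\big)L$. (3) Vector transport: for all $\Sigma_1,\Sigma_2\in\mathcal{M}$ and all mapped tangent vectors $\xi'$ at $\Sigma_1$, $\mathcal{T}'_{\Sigma_1,\Sigma_2}(\xi')=\xi'$. (4) Exponential map: $\mathrm{Exp}_\Sigma(\xi')=\Sigma\exp(L^{-\top}\xi'L^\top)$. (5) Adjoint vector transport: for all $\Sigma_1,\Sigma_2\in\mathcal{M}$, all $\xi'\in T_{\Sigma_1}\mathcal{M}$ and all $\eta'\in T_{\Sigma_2}\mathcal{M}$, $g'_{\Sigma_1}(\xi',\mathcal{T}'^{*}_{\Sigma_1,\Sigma_2}\eta')=g'_{\Sigma_2}(\mathcal{T}'_{\Sigma_1,\Sigma_2}\xi',\eta')$. (6) Retraction: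 the second-order approximate retraction becomes $\mathrm{Ret}_\Sigma(\xi')=\Sigma+L\,\xi'L^\top+\tfrac12\,L\,\xi'^{\,2}L^\top$.
   Context: $\mathcal{M}=\mathbb{S}_{++}^n$ is the manifold of real symmetric positive definite $n\times n$ matrices; for each $\Sigma\in\mathcal{M}$ the tangent space $T_\Sigma\mathcal{M}$ is identified with the space of real symmetric $n\times n$ matrices. In the Cholesky decomposition $\Sigma=LL^\top$, $L$ is lower triangular (with positive diagonal); $L_1,L_2$ denote the Cholesky factors of $\Sigma_1,\Sigma_2$. $\exp$ of a matrix is the matrix exponential and $\mathrm{tr}$ is the trace. Unmapped operators, for $\xi,\eta\in T_\Sigma\mathcal{M}$: metric $g_\Sigma(\xi,\eta)=\mathrm{tr}(\Sigma^{-1}\xi\Sigma^{-1}\eta)$; Riemannian gradient $\nabla f(\Sigma)=\tfrac12\Sigma\big(\nabla_E f(\Sigma)+(\nabla_E f(\Sigma))^\top\big)\Sigma$, where $\nabla_E f(\Sigma)\in\mathbb{R}^{n\times n}$ is the Euclidean gradient of the real-valued function $f$; exponential map $\mathrm{Exp}_\Sigma(\xi)=\Sigma\exp(\Sigma^{-1}\xi)$; vector transport $\mathcal{T}_{\Sigma_1,\Sigma_2}(\xi)=L_2L_1^{-1}\,\xi\,L_1^{-\top}L_2^\top$ for $\xi\in T_{\Sigma_1}\mathcal{M}$, with values in $T_{\Sigma_2}\mathcal{M}$; adjoint vector transport $\mathcal{T}^*_{\Sigma_1,\Sigma_2}:T_{\Sigma_2}\mathcal{M}\to T_{\Sigma_1}\mathcal{M}$,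 defined by $g_{\Sigma_1}(\xi,\mathcal{T}^*_{\Sigma_1,\Sigma_2}\eta)=g_{\Sigma_2}(\mathcal{T}_{\Sigma_1,\Sigma_2}\xi,\eta)$ for all $\xi\in T_{\Sigma_1}\mathcal{M}$, $\eta\in T_{\Sigma_2}\mathcal{M}$; approximate (second-order Taylor) retraction $\mathrm{Ret}_\Sigma(\xi)=\Sigma+\xi+\tfrac12\xi\Sigma^{-1}\xi$. Operators after the mapping are the same operators read in terms of mapped vectors. A primed tangent vector at $\Sigma$ denotes the image under the mapping at $\Sigma$ of the corresponding unprimed one. Thus $g'_\Sigma(\xi',\eta'):=g_\Sigma(\xi,\eta)$; $\nabla' f(\Sigma)$ is the image of $\nabla f(\Sigma)$ under the mapping at $\Sigma$; $\mathcal{T}'_{\Sigma_1,\Sigma_2}(\xi')$ is the image under the mapping at $\Sigma_2$ of $\mathcal{T}_{\Sigma_1,\Sigma_2}(\xi)$; $\mathcal{T}'^{*}_{\Sigma_1,\Sigma_2}(\eta')$ is the image under the mapping at $\Sigma_1$ of $\mathcal{T}^*_{\Sigma_1,\Sigma_2}(\eta)$; and $\mathrm{Exp}_\Sigma(\xi')$, $\mathrm{Ret}_\Sigma(\xi')$ denote $\mathrm{Exp}_\Sigma(\xi)$, $\mathrm{Ret}_\Sigma(\xi)$ expressed as functions of $\xi'$. *)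

(* Defs.v *)
From HB Require Import structures.
From mathcomp Require Import all_boot all_order all_algebra.
From mathcomp Require Import all_classical all_reals all_analysis.

Set Implicit Arguments.
Unset Strict Implicit.
Unset Printing Implicit Defensive.

Import Order.TTheory GRing.Theory Num.Theory.
Import numFieldNormedType.Exports.

Local Open Scope classical_set_scope.
Local Open Scope ring_scope.

Section Unmapped.
Context {R : realType} {n : nat}.
Implicit Types (S L xi eta : 'M[R]_n) (f : 'M[R]_n -> R).

Definition tangent : set 'M[R]_n := [set xi | xi \is symmetricmx].

Definition spd : set 'M[R]_n :=
  [set S | S \is symmetricmx /\
           forall u : 'cV[R]_n, u != 0 -> 0 < (u^T *m S *m u) 0 0].

Definition is_cholesky S L : Prop :=
  [/\ is_trig_mx L, forall i, 0 < L i i & S = L *m L^T].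

(* The Cholesky factor of [S]; junk value [0] when there is none, which does
   not occur on [spd]. *)
Definition cholesky S : 'M[R]_n := xget 0 [set L | is_cholesky S L].

Definition expmx (A : 'M[R]_n) : 'M[R]_n :=
  limn (series (fun k => (k`!%:R)^-1 *: A ^+ k)).

Definition metric S xi eta : R :=
  \tr (invmx S *m xi *m invmx S *m eta).

(* Matrix of the n^2 partial derivatives: [f] is a function of all the entries,
   so the Euclidean gradient need not be symmetric. *)
Definition egrad f S : 'M[R]_n := \matrix_(i, j) 'D_(delta_mx i j) f S.

Definition rgrad f S : 'M[R]_n :=
  2^-1 *: (S *m (egrad f S + (egrad f S)^T) *m S).

Definition Exp S xi : 'M[R]_n := S *m expmx (invmx S *m xi).

Definition transport S1 S2 xi : 'M[R]_n :=
  let L1 := cholesky S1 in let L2 := cholesky S2 in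
  L2 *m invmx L1 *m xi *m (invmx L1)^T *m L2^T.

Definition is_adjoint_transport S1 S2 eta zeta : Prop :=
  tangent zeta /\
  forall xi, tangent xi -> metric S1 xi zeta = metric S2 (transport S1 S2 xi) eta.

(* The vector characterized by the adjunction identity; for [S1], [S2] in [spd]
   and [eta] in [tangent] it exists and is unique. *)
Definition adj_transport S1 S2 eta : 'M[R]_n :=
  xget 0 [set zeta | is_adjoint_transport S1 S2 eta zeta].

Definition Ret S xi : 'M[R]_n :=
  S + xi + 2^-1 *: (xi *m invmx S *m xi).

End Unmapped.

(* Suffix [m]: operators read in terms of mapped vectors. [unmap_tan S] recovers
   the unmapped tangent vector from its image under [map_tan S]. *)
Section Mapped.
Context {R : realType} {n : nat}.
Implicit Types (S xi eta : 'M[R]_n) (f : 'M[R]_n -> R).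

Definition map_tan S xi : 'M[R]_n :=
  let L := cholesky S in invmx L *m xi *m (invmx L)^T.

Definition unmap_tan S (xi' : 'M[R]_n) : 'M[R]_n :=
  let L := cholesky S in L *m xi' *m L^T.

Definition mapped_tangent S : set 'M[R]_n := map_tan S @` tangent.

Definition metricm S (xi' eta' : 'M[R]_n) : R :=
  metric S (unmap_tan S xi') (unmap_tan S eta').

Definition rgradm f S : 'M[R]_n := map_tan S (rgrad f S).

Definition transportm S1 S2 (xi' : 'M[R]_n) : 'M[R]_n :=
  map_tan S2 (transport S1 S2 (unmap_tan S1 xi')).

Definition adj_transportm S1 S2 (eta' : 'M[R]_n) : 'M[R]_n :=
  map_tan S1 (adj_transport S1 S2 (unmap_tan S2 eta')).

Definition Expm S (xi' : 'M[R]_n) : 'M[R]_n := Exp S (unmap_tan S xi').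

Definition Retm S (xi' : 'M[R]_n) : 'M[R]_n := Ret S (unmap_tan S xi').

End Mapped.

(* Main.v *)
Require Import Defs.
From HB Require Import structures.
From mathcomp Require Import all_boot all_order all_algebra.
From mathcomp Require Import all_classical all_reals all_analysis.

Import Order.TTheory GRing.Theory Num.Theory.
Import numFieldNormedType.Exports.

Local Open Scope classical_set_scope.
Local Open Scope ring_scope.

(** Each of the seven claims is matrix algebra once the factor [L] of
[S = L *m L^T] is known to be an invertible genuine Cholesky factor: then
[invmx S = (invmx L)^T *m invmx L], and congruence by [L] turns the metric at
[S] into the metric at the identity, that is, the trace form.

Two objects are defined by choice, so that their existence must be proved.
The Cholesky factor exists by induction on the size ([cholesky_exists]): one
step of block elimination on the top left entry, which is positive, is a
congruence to [1] plus a smaller matrix, and congruence preserves positive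
definiteness ([spd_congr]).  The adjoint of the transport exists because the
transport is the identity on mapped vectors ([transport_unmap]) while the
mapped metric does not depend on the base point ([metric_unmap]); hence the
mapped adjoint may be taken to be the identity as well
([adjoint_transport_exists]), and the adjunction identity then holds for the
chosen vector by its definition. *)

Lemma symmetricmxP {R : realType} {n : nat} (A : 'M[R]_n) :
  A \is symmetricmx <-> A^T = A.
Proof.
rewrite is_hermitianmxE expr0 scale1r map_mx_id //.
by split=> [/eqP <-//|->].
Qed.

Lemma symmetricmx_congr {R : realType} {m n : nat}
    (M : 'M[R]_(m, n)) (A : 'M[R]_n) :
  A \is symmetricmx -> M *m A *m M^T \is symmetricmx.
Proof.
by move=> /symmetricmxP sA; apply/symmetricmxP; rewrite !trmx_mul trmxK sA mulmxA.
Qed.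

(** Only injectivity of [N^T] matters, so that both changes of basis and
restrictions to a coordinate subspace are instances. *)
Lemma spd_congr {R : realType} {m n : nat} (N : 'M[R]_(m, n)) (S : 'M[R]_n) :
  (forall u : 'cV[R]_m, N^T *m u = 0 -> u = 0) -> spd S -> spd (N *m S *m N^T).
Proof.
move=> injN [sS pS]; split; first exact: symmetricmx_congr.
move=> u u0; have Nu0 : N^T *m u != 0.
  by apply: contraNneq u0 => /injN ->.
by have := pS _ Nu0; rewrite trmx_mul trmxK !mulmxA.
Qed.

(** With [l ^+ 2] the top left entry of [S] and [l *: v] the column below it,
[M := block_mx l 0 v 1] satisfies [S = M *m block_mx 1 0 0 C *m M^T], where
[C] is the Schur complement; a factor [L'] of [C] then gives the factor
[block_mx l 0 v L'] of [S]. *)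
Lemma cholesky_exists {R : realType} {n : nat} (S : 'M[R]_n) :
  spd S -> exists L, is_cholesky S L.
Proof.
elim: n S => [|n IHn] S spdS.
  exists 0; split; [|by case|by apply/matrixP; case].
  by apply/is_trig_mxP; case.
change 'M[R]_(1 + n) in (type of S).
have [/symmetricmxP sS pS] := spdS.
pose a : R := S 0 0.
have a_gt0 : 0 < a.
  have e0 : (delta_mx 0 0 : 'cV[R]_(1 + n)) != 0.
    by apply/eqP => /matrixP/(_ 0 0)/eqP; rewrite !mxE oner_eq0.
  by have := pS _ e0; rewrite trmx_delta -rowE -colE !mxE.
pose l := Num.sqrt a.
have l_gt0 : 0 < l by rewrite sqrtr_gt0.
have l_neq0 : l != 0 by rewrite gt_eqF.
have ll : l * l = a by rewrite -expr2 sqr_sqrtr // ltW.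
pose v : 'cV[R]_n := l^-1 *: dlsubmx S.
pose C : 'M[R]_n := drsubmx S - v *m v^T.
pose M : 'M[R]_(1 + n) := block_mx l%:M 0 v 1%:M.
have lv : l *: v = dlsubmx S by rewrite scalerA divff ?scale1r.
have lvT : l *: v^T = ursubmx S.
  have -> : l *: v^T = (l *: v)^T by apply/matrixP => i j; rewrite !mxE.
  by rewrite lv trmx_dlsub sS.
have S_M : S = M *m block_mx 1%:M 0 0 C *m M^T.
  rewrite /M tr_block_mx !mulmx_block !tr_scalar_mx trmx0.
  rewrite !(mulmx0, mul0mx, mulmx1, mul1mx, addr0, add0r).
  rewrite -scalar_mxM ll mul_scalar_mx mul_mx_scalar lv lvT /C addrC subrK.
  rewrite -{1}[S]submxK; congr block_mx.
  rewrite [LHS]mx11_scalar; congr _%:M.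
  by rewrite !mxE; congr (S _ _); apply/val_inj.
have M_unit : M \in unitmx.
  by rewrite unitmxE det_lblock det_scalar expr1 det1 mulr1 unitfE.
(* [N] extracts the lower right block after undoing the congruence by [M]. *)
pose N : 'M[R]_(n, 1 + n) := row_mx 0 1%:M *m invmx M.
have C_N : C = N *m S *m N^T.
  rewrite /N S_M trmx_mul !mulmxA mulmxKV // -[_ *m M^T *m _]mulmxA.
  rewrite -trmx_mul mulVmx // trmx1 mulmx1 tr_row_mx trmx0 trmx1.
  rewrite mul_row_block mul_row_col.
  by rewrite !(mulmx0, mul0mx, mulmx1, mul1mx, addr0, add0r).
have spdC : spd C.
  rewrite C_N; apply: spd_congr => // u.
  rewrite /N trmx_mul -mulmxA => /(congr1 (mulmx M^T)).
  rewrite mulmxA -trmx_mul mulVmx // trmx1 mul1mx mulmx0 tr_row_mx trmx0 trmx1.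
  by rewrite mul_col_mx mul1mx => /(congr1 dsubmx); rewrite col_mxKd linear0.
have [L' [trigL' posL' C_L']] := IHn C spdC.
pose L : 'M[R]_(1 + n) := block_mx l%:M 0 v L'.
(* The fields of [is_cholesky] are proved at size [1 + n], where the block
   lemmas apply, and used at the convertible size [n.+1]. *)
have trigL : is_trig_mx L.
  by rewrite is_trig_block_mx // eqxx scalar_mx_is_trig.
have posL (i : 'I_(1 + n)) : 0 < L i i.
  rewrite -[i]splitK; case: (fintype.split i) => j /=; last by rewrite block_mxEdr.
  by rewrite block_mxEul !mxE eqxx.
have S_L : S = L *m L^T.
  rewrite S_M C_L' /M /L !tr_block_mx !mulmx_block !tr_scalar_mx trmx0.
  by rewrite !(mulmx0, mul0mx, mulmx1, mul1mx, addr0, add0r).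
by exists L.
Qed.

Lemma choleskyP {R : realType} {n : nat} (S : 'M[R]_n) :
  spd S -> is_cholesky S (cholesky S).
Proof. by move=> spdS; apply: xgetPex; exact: cholesky_exists. Qed.

Lemma cholesky_mul {R : realType} {n : nat} (S : 'M[R]_n) :
  spd S -> S = cholesky S *m (cholesky S)^T.
Proof. by case/choleskyP. Qed.

Lemma cholesky_unit {R : realType} {n : nat} (S : 'M[R]_n) :
  spd S -> cholesky S \in unitmx.
Proof.
case/choleskyP=> trigL posL _; rewrite unitmxE det_trig // unitfE.
by apply/prodf_neq0 => i _; rewrite gt_eqF.
Qed.

Lemma mulmx_trV {R : realType} {n : nat} (L : 'M[R]_n) :
  L \in unitmx -> L^T *m (invmx L)^T = 1%:M.
Proof. by move=> uL; rewrite -trmx_mul mulVmx ?trmx1. Qed.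

Lemma mulmx_Vtr {R : realType} {n : nat} (L : 'M[R]_n) :
  L \in unitmx -> (invmx L)^T *m L^T = 1%:M.
Proof. by move=> uL; rewrite -trmx_mul mulmxV ?trmx1. Qed.

Lemma invmx_spd {R : realType} {n : nat} (S : 'M[R]_n) :
  spd S -> invmx S = (invmx (cholesky S))^T *m invmx (cholesky S).
Proof.
move=> spdS; have uL := cholesky_unit _ spdS; have SL := cholesky_mul _ spdS.
have uS : S \in unitmx by rewrite SL unitmx_mul unitmx_tr uL.
apply: (can_inj (mulmxK uS)); rewrite mulVmx // {3}SL mulmxA mulmxKV //.
by rewrite mulmx_Vtr.
Qed.

Lemma map_tanK {R : realType} {n : nat} (S xi : 'M[R]_n) :
  spd S -> unmap_tan S (map_tan S xi) = xi.
Proof.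
move=> /cholesky_unit uL; rewrite /unmap_tan /map_tan !mulmxA mulmxV // mul1mx.
by rewrite -mulmxA mulmx_Vtr // mulmx1.
Qed.

Lemma unmap_tanK {R : realType} {n : nat} (S xi' : 'M[R]_n) :
  spd S -> map_tan S (unmap_tan S xi') = xi'.
Proof.
move=> /cholesky_unit uL; rewrite /unmap_tan /map_tan !mulmxA mulVmx // mul1mx.
by rewrite -mulmxA mulmx_trV // mulmx1.
Qed.

Lemma invmx_mul_unmap {R : realType} {n : nat} (S xi' : 'M[R]_n) :
  spd S -> invmx S *m unmap_tan S xi' =
    (invmx (cholesky S))^T *m xi' *m (cholesky S)^T.
Proof.
move=> spdS; rewrite invmx_spd // /unmap_tan !mulmxA mulmxKV //.
exact: cholesky_unit.
Qed.

Lemma metric_unmap {R : realType} {n : nat} (S xi' eta' : 'M[R]_n) :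
  spd S -> metricm S xi' eta' = \tr (xi' *m eta').
Proof.
move=> spdS; have uL := cholesky_unit _ spdS.
rewrite /metricm /metric -[_ *m _ *m unmap_tan _ eta']mulmxA !invmx_mul_unmap //.
rewrite !mulmxA -[_ *m _^T *m _^T]mulmxA mulmx_trV // mulmx1.
by rewrite mxtrace_mulC !mulmxA mulmx_trV // mul1mx.
Qed.

Lemma transport_unmap {R : realType} {n : nat} (S1 S2 xi' : 'M[R]_n) :
  spd S1 -> transport S1 S2 (unmap_tan S1 xi') = unmap_tan S2 xi'.
Proof.
move=> /cholesky_unit uL; rewrite /transport /unmap_tan /= !mulmxA mulmxKV //.
by rewrite -[_ *m _^T *m (invmx _)^T]mulmxA mulmx_trV // mulmx1.
Qed.

(** On mapped vectors the adjunction identity reads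
[\tr (xi' *m zeta') = \tr (xi' *m eta')], which [zeta' = eta'] solves. *)
Lemma adjoint_transport_exists {R : realType} {n : nat} (S1 S2 eta : 'M[R]_n) :
  spd S1 -> spd S2 -> tangent eta ->
  exists zeta, is_adjoint_transport S1 S2 eta zeta.
Proof.
move=> spd1 spd2 teta; exists (unmap_tan S1 (map_tan S2 eta)); split.
  by apply/symmetricmx_congr/symmetricmx_congr.
move=> xi txi; rewrite -[xi](map_tanK S1) // transport_unmap //.
rewrite -[in RHS](map_tanK S2 eta) //.
by rewrite -/(metricm S1 _ _) -/(metricm S2 _ _) !metric_unmap.
Qed.

Lemma adj_transportP {R : realType} {n : nat} (S1 S2 eta : 'M[R]_n) :
  spd S1 -> spd S2 -> tangent eta ->
  is_adjoint_transport S1 S2 eta (adj_transport S1 S2 eta).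
Proof.
by move=> spd1 spd2 teta; apply: xgetPex; exact: adjoint_transport_exists.
Qed.

Theorem proposition2 (R : realType) (n : nat) (n_ge1 : (1 <= n)%N) :
  (* the two descriptions of the mapping *)
  (forall S xi xi' : 'M[R]_n, spd S -> tangent xi ->
     xi' = map_tan S xi <-> xi = unmap_tan S xi') /\
  (* (1) *)
  (forall S xi' eta' : 'M[R]_n,
     spd S -> mapped_tangent S xi' -> mapped_tangent S eta' ->
     metricm S xi' eta' = \tr (xi' *m eta')) /\
  (* (2) *)
  (forall f : 'M[R]_n -> R, (forall S, spd S -> differentiable f S) ->
     forall S : 'M[R]_n, spd S ->
     rgradm f S =
       2^-1 *: ((cholesky S)^T *m (egrad f S + (egrad f S)^T) *m cholesky S)) /\
  (* (3) *)
  (forall S1 S2 xi' : 'M[R]_n, spd S1 -> spd S2 -> mapped_tangent S1 xi' ->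
     transportm S1 S2 xi' = xi') /\
  (* (4) *)
  (forall S xi' : 'M[R]_n, spd S -> mapped_tangent S xi' ->
     Expm S xi' =
       S *m expmx ((invmx (cholesky S))^T *m xi' *m (cholesky S)^T)) /\
  (* (5) *)
  (forall S1 S2 xi' eta' : 'M[R]_n, spd S1 -> spd S2 ->
     mapped_tangent S1 xi' -> mapped_tangent S2 eta' ->
     metricm S1 xi' (adj_transportm S1 S2 eta') =
       metricm S2 (transportm S1 S2 xi') eta') /\
  (* (6) *)
  (forall S xi' : 'M[R]_n, spd S -> mapped_tangent S xi' ->
     Retm S xi' =
       S + cholesky S *m xi' *m (cholesky S)^T
         + 2^-1 *: (cholesky S *m xi' ^+ 2 *m (cholesky S)^T)).
Proof.
split; [|split; [|split; [|split; [|split; [|split]]]]].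
- by move=> S xi xi' spdS _; split=> ->; rewrite ?map_tanK ?unmap_tanK.
- by move=> S xi' eta' spdS _ _; exact: metric_unmap.
- move=> f _ S spdS; have uL := cholesky_unit _ spdS.
  rewrite /rgradm /rgrad /map_tan /=.
  rewrite -scalemxAr -scalemxAl; congr (_ *: _).
  rewrite {2 5}(cholesky_mul _ spdS) !mulmxA mulVmx // mul1mx.
  by rewrite -[_ *m (invmx _)^T]mulmxA mulmx_trV // mulmx1.
- move=> S1 S2 xi' spd1 spd2 _.
  by rewrite /transportm transport_unmap // unmap_tanK.
- by move=> S xi' spdS _; rewrite /Expm /Exp invmx_mul_unmap.
- move=> S1 S2 _ _ spd1 spd2 [xi txi <-] [eta teta <-].
  have [_ adj] := adj_transportP _ _ _ spd1 spd2 teta.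
  rewrite /metricm /adj_transportm /transportm !map_tanK //.
  exact: adj.
- move=> S xi' spdS _; have uL := cholesky_unit _ spdS.
  rewrite /Retm /Ret -[_ *m invmx S *m _]mulmxA invmx_mul_unmap //.
  rewrite /unmap_tan /= !mulmxA -[_ *m _^T *m (invmx _)^T]mulmxA mulmx_trV //.
  (* [xi' ^+ 2] is convertible to [xi' *m xi'], so that [mulmxA] has already
     split it. *)
  by rewrite mulmx1.
Qed.
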